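(* If $A$ is a finite abelian group of odd order, then every path graph is $A$-cordial (i.e., $A$ is $\mathbb{P}$-cordial).
   Context: For a finite abelian group $A$ of order $n$ (written additively) and a graph $G$, a vertex labeling $\ell:V(G)\to A$ induces an edge labeling assigning to each edge $uv$ the label $\ell(u)+\ell(v)$. Let $\lambda^v=(\lambda^v_1\ge\dots\ge\lambda^v_n\ge 0)$ be the numbers of vertices carrying each element of $A$ (over all $n$ elements, in decreasing order, zeros allowed), and $\lambda^e$ the analogous sequence for edge labels. A sequence $\lambda$ is almost rectangular if $\lambda_i\in\{\lambda_1,\lambda_1-1,0\}$ for all $i$. The graph $G$ is $A$-cordial if some vertex labeling by $A$ makes both $\lambda^v$ and $\lambda^e$ almost rectangular. $\mathbb{P}$ is the class of all path graphs; $A$ is $\mathbb{P}$-cordial if every path graph is $A$-cordial. *)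

(* Defs.v *)
From HB Require Import structures.
From mathcomp Require Import all_boot all_order all_algebra.

Set Implicit Arguments.
Unset Strict Implicit.
Unset Printing Implicit Defensive.

Import GRing.Theory.
Local Open Scope ring_scope.

Record sgraph := SGraph {
  vertex :> finType;
  adj : rel vertex;
  adj_sym : symmetric adj;
  adj_irr : irreflexive adj }.

Definition edges (G : sgraph) : {set {set G}} :=
  [set [set u; v] | u in G, v in adj u].

(* As [adj] is irreflexive, an edge [set u; v] has two distinct elements, and
   its label is l u + l v. *)
Definition edge_label (A : finZmodType) (G : sgraph) (l : G -> A)
    (E : {set G}) : A := \sum_(u in E) l u.

Lemma edge_labelE (A : finZmodType) (G : sgraph) (l : G -> A) (u v : G) :
  adj u v -> edge_label l [set u; v] = l u + l v.
Proof.
move=> uv; have neq_uv : u != v by apply: contraTneq uv => ->; rewrite adj_irr.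
by rewrite /edge_label big_setU1 ?inE //= big_set1.
Qed.

(* The #|A| multiplicities, including the zero ones, in decreasing order. *)
Definition lambda_v (A : finZmodType) (G : sgraph) (l : G -> A) : seq nat :=
  sort geq [seq #|[set u : G | l u == a]| | a : A].

Definition lambda_e (A : finZmodType) (G : sgraph) (l : G -> A) : seq nat :=
  sort geq [seq #|[set E in edges G | edge_label l E == a]| | a : A].

(* Multiplicities differ by at most one, as Hovey requires.  The definition is
   sometimes written with 0 as a third admissible value.  This is harmless for
   the zeros that pad a partition beyond its #|A| entries, but for the entries
   themselves it would make every graph cordial, by [constant_labelling] below.
   The version used here implies the weaker one, by [almost_rectangularW]. *)
Definition almost_rectangular (s : seq nat) : bool :=
  all (fun x => x \in [:: head 0%N s; (head 0%N s).-1]) s.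

Definition weak_almost_rectangular (s : seq nat) : bool :=
  all (fun x => x \in [:: head 0%N s; (head 0%N s).-1; 0%N]) s.

Lemma almost_rectangularW (s : seq nat) :
  almost_rectangular s -> weak_almost_rectangular s.
Proof. by apply: sub_all => x; rewrite !inE => /orP[] ->; rewrite ?orbT. Qed.

Lemma constant_labelling (A : finZmodType) (G : sgraph) :
  let l := fun _ : G => 0 : A in
  weak_almost_rectangular (lambda_v l) /\ weak_almost_rectangular (lambda_e l).
Proof.
have war (T : finType) (B : {set T}) (f : T -> A) :
    {in B, forall x, f x = 0} ->
    weak_almost_rectangular
      (sort geq [seq #|[set x in B | f x == a]| | a : A]).
  move=> f0; set s := sort _ _.
  have sE x : x \in s -> x = #|B| \/ x = 0%N.
    rewrite mem_sort => /imageP[a _ ->]; have [->|a0] := eqVneq a 0.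
      by left; apply: eq_card => y; rewrite inE andb_idr // => /f0->.
    right; apply/eqP; rewrite cards_eq0; apply/eqP/setP=> y; rewrite !inE.
    by apply/negP=> /andP[/f0-> /eqP z0]; rewrite -z0 eqxx in a0.
  have : sorted geq s by apply: sort_sorted => m n; apply: leq_total.
  rewrite /weak_almost_rectangular; case: s sE => // h s sE /= hs.
  rewrite !inE eqxx /=; apply/allP=> x xs; rewrite !inE.
  have geq_trans : transitive geq by move=> n m p nm pn; apply: leq_trans nm.
  have xh : (x <= h)%N by have /allP/(_ x xs) := order_path_min geq_trans hs.
  have [xB|->] := sE x (mem_behead (s := h :: s) xs); last by rewrite !orbT.
  have [hB|h0] := sE h (mem_head h s); first by rewrite xB hB eqxx.
  by move: xh; rewrite h0 leqn0 => ->.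
split; last first.
  by apply: (war _ (edges G) (@edge_label A G _)) => E _; apply: big1.
have := war _ [set: G] (fun=> 0) (fun _ _ => erefl).
rewrite /lambda_v; congr (weak_almost_rectangular (sort _ _)).
by apply: eq_map => a; apply: eq_card => x; rewrite !inE.
Qed.

Definition cordial (A : finZmodType) (G : sgraph) : Prop :=
  exists l : G -> A,
    almost_rectangular (lambda_v l) /\ almost_rectangular (lambda_e l).

Definition path_adj (m : nat) : rel 'I_m :=
  fun i j => (i.+1 == j :> nat) || (j.+1 == i :> nat).

Lemma path_adj_sym (m : nat) : symmetric (@path_adj m).
Proof. by move=> i j; rewrite /path_adj orbC. Qed.

Lemma path_adj_irr (m : nat) : irreflexive (@path_adj m).
Proof. by move=> i; rewrite /path_adj orbb gtn_eqF. Qed.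

Definition path_graph (m : nat) : sgraph :=
  SGraph (@path_adj_sym m) (@path_adj_irr m).

Definition sgraph_iso (G H : sgraph) : Prop :=
  exists2 f : G -> H, bijective f & {mono f : u v / adj u v}.

Definition is_path_graph (G : sgraph) : Prop :=
  exists2 m : nat, (0 < m)%N & sgraph_iso (path_graph m) G.

Definition class_cordial (A : finZmodType) (C : sgraph -> Prop) : Prop :=
  forall G : sgraph, C G -> cordial A G.

(* Main.v *)
Require Import Defs.
From mathcomp Require Import all_boot all_order all_algebra.
From mathcomp Require Import zify.

Set Implicit Arguments.
Unset Strict Implicit.
Unset Printing Implicit Defensive.

(** An odd abelian group A is harmonious: it has a cyclic enumeration whose sums
    of consecutive terms again enumerate A.  Repeating such an enumeration
    periodically along a path labels both vertices and edges with balanced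
    multiplicities.  To get one, adjoin the elements of A one at a time to the
    trivial subgroup: if b_0, b_1, ... is a harmonious enumeration of H and m is
    the order of x modulo H, then t |-> (t mod m) x + b_(t div m) is one of
    H + <x>.  Its t-th sum lies in the coset of (2 t + 1) x, which determines
    t mod m as m is odd; within a coset the sums are, up to a translation,
    either all the 2 b_j or all the b_j + b_(j+1). *)

Import GRing.Theory.

(** * Congruences and the counting of residues *)

Lemma eqn_mod_mul (m N s t : nat) : 0 < m ->
  (s == t %[mod m * N]) = (s == t %[mod m]) && (s %/ m == t %/ m %[mod N]).
Proof.
move=> m0; have modE u : u %% (m * N) = (u %/ m %% N) * m + u %% m.
  rewrite modn_divl [in LHS](divn_eq (u %% (m * N)) m) [m * N]mulnC.
  by rewrite modn_dvdm ?dvdn_mull.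
rewrite !modE; apply/eqP/andP => [e|[/eqP-> /eqP->] //].
have := congr1 (modn^~ m) e; rewrite !modnMDl !modn_mod => e1.
split; apply/eqP=> //.
by move: e; rewrite e1 => /addIn/eqP; rewrite eqn_pmul2r // => /eqP.
Qed.

Lemma count_mod (N m r : nat) : r < N ->
  \sum_(i < m) (i == r %[mod N] : nat) = (m + (N.-1 - r)) %/ N.
Proof.
move=> rN; have N0 : 0 < N by apply: leq_ltn_trans rN.
elim: m => [|m IH]; first by rewrite big_ord0 divn_small //; lia.
(* Passing from [m] to [m.+1] raises the quotient exactly when [N] divides [m + (N - r)], that is,
   when [m] is congruent to [r]. *)
rewrite big_ord_recr /= IH addSn divnS // addnC; congr (nat_of_bool _ + _).
rewrite -addnS -(eqn_modDr (N - r)) subnKC 1?ltnW // modnn.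
by rewrite /dvdn; congr ((m + _) %% N == 0); lia.
Qed.

(** With [r] reduced modulo [N], the shift [N.-1 - r] in the exact count is below [N], so it raises
    [m %/ N] by at most one. *)
Lemma count_mod_bounds (N m r : nat) : 0 < N ->
  m %/ N <= \sum_(i < m) (i == r %[mod N] : nat) <= (m %/ N).+1.
Proof.
move=> N0; rewrite -(modn_mod r N) count_mod ?ltn_mod //.
rewrite leq_div2r ?leq_addr //=.
by rewrite -add1n -divnMDl // mul1n addnC leq_div2r // leq_add2r; lia.
Qed.

Lemma eqn_mod_double (m a b : nat) : odd m ->
  (2 * a == 2 * b %[mod m]) = (a == b %[mod m]).
Proof.
move=> m_odd; wlog le_ab : a b / a <= b.
  move=> wl; have [/wl//|/ltnW/wl] := leqP a b.
  by rewrite eq_sym => ->; rewrite eq_sym.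
rewrite eq_sym [RHS]eq_sym !eqn_mod_dvd ?leq_mul2l //.
by rewrite -mulnBr Gauss_dvdr // coprimen2.
Qed.

(** The head of the sorted list is its maximum: if it is [k], all entries are [k]; if it is [k.+1],
    the others are at most one less. *)
Lemma almost_rectangular_sort (T : finType) (F : T -> nat) (k : nat) :
  (forall a, k <= F a <= k.+1) ->
  almost_rectangular (sort geq [seq F a | a : T]).
Proof.
move=> Fk; set s := sort _ _.
have sk x : x \in s -> k <= x <= k.+1.
  by rewrite mem_sort => /imageP[a _ ->].
have : sorted geq s by apply: sort_sorted => m n; apply: leq_total.
rewrite /almost_rectangular; case: s sk => // h s sk hs.
have geq_trans : transitive geq by move=> n m p nm pn; apply: leq_trans nm.
apply/allP=> x xs; have xh : x <= h.
  move: xs; rewrite inE => /predU1P[->//|].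
  exact: (allP (order_path_min geq_trans hs)).
have := sk x xs; have := sk h (mem_head _ _); rewrite !inE /=; lia.
Qed.

Local Open Scope ring_scope.

(** * Harmonious enumerations of groups of odd order *)

Section OddGroup.
Variable A : finZmodType.

(** Translation by [x] permutes [A], hence preserves the sum of all its elements. *)
Lemma mulr_card (x : A) : x *+ #|A| = 0.
Proof.
have : \sum_(a : A) (a + x) = \sum_(a : A) a.
  by rewrite [RHS](reindex_inj (addIr x)).
by rewrite big_split sumr_const => /(canRL (addKr _)); rewrite addNr.
Qed.

Lemma double_inj : odd #|A| -> injective (fun x : A => x + x).
Proof.
move=> hodd x y /eqP; rewrite -subr_eq0 opprD addrACA => /eqP d0.
apply/eqP; rewrite -subr_eq0 -(mulr_card (x - y)) -(odd_double_half #|A|) hodd.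
by rewrite mulrS -mul2n mulrnA mulr2n d0 mul0rn addr0.
Qed.

(** Periodicity and injectivity on a period in one equation; with indices in [nat], the cyclic
    successor is plain [i.+1]. *)
Definition mod_inj (N : nat) (f : nat -> A) :=
  forall i j, (f i == f j) = (i == j %[mod N]).

Lemma mod_inj_ord (N : nat) (f : nat -> A) :
  mod_inj N f -> injective (fun i : 'I_N => f i).
Proof.
by move=> f_inj i j /eqP; rewrite f_inj !modn_small // => /eqP/val_inj.
Qed.

Definition harmonious (H : {set A}) (N : nat) (f : nat -> A) :=
  [/\ (0 < N)%N, mod_inj N f, mod_inj N (fun i => f i + f i.+1)
    & forall a, a \in H <-> exists i, f i = a].

(** * Adjoining [x] to a subgroup [H], with [m] the order of [x] modulo [H] *)

Section Extension.
Variables (H : {set A}) (x : A) (m : nat).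
Hypothesis H0 : 0 \in H.
Hypothesis HB : forall a b, a \in H -> b \in H -> a - b \in H.
Hypothesis m_gt0 : (0 < m)%N.
Hypothesis xm : x *+ m \in H.
Hypothesis m_min : forall k, (0 < k)%N -> x *+ k \in H -> (m <= k)%N.

Let HD a b : a \in H -> b \in H -> a + b \in H.
Proof. by move=> aH bH; rewrite -[b]opprK HB // -[- b]sub0r HB. Qed.

Let HM a k : a \in H -> a *+ k \in H.
Proof. by move=> aH; elim: k => // k IH; rewrite mulrS HD. Qed.

Let x_div k : x *+ (k %/ m * m) \in H.
Proof. by rewrite mulnC mulrnA HM. Qed.

(** A nonzero remainder [k %% m] would also bring [x] into [H], against the minimality of [m]. *)
Lemma mem_mulrn_dvd k : x *+ k \in H -> (m %| k)%N.
Proof.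
move=> xk; rewrite /dvdn; apply/eqP/eqP; rewrite -leqn0 leqNgt; apply/negP=> r0.
have := ltn_pmod k m_gt0; rewrite ltnNge m_min //.
have -> : x *+ (k %% m) = x *+ k - x *+ (k %/ m * m).
  by rewrite {2}(divn_eq k m) mulrnDr addrC addKr.
exact: HB.
Qed.

Lemma coset_mod (a b : nat) (h h' : A) : h \in H -> h' \in H ->
  x *+ a + h = x *+ b + h' -> a = b %[mod m].
Proof.
wlog le_ab : a b h h' / (a <= b)%N.
  move=> wl hH hH' e; have [le_ab|/ltnW le_ba] := leqP a b; first exact: wl e.
  by apply/esym; apply: wl (esym e).
move=> hH hH' e; apply/esym/eqP; rewrite eqn_mod_dvd //; apply: mem_mulrn_dvd.
move: e; rewrite -{1}(subnKC le_ab) mulrnDr -addrA => /addrI e.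
by rewrite -[x *+ _](addrK h') -e HB.
Qed.

Hypothesis hodd : odd #|A|.
Variables (N : nat) (f : nat -> A).
Hypothesis hf : harmonious H N f.

Let g t := x *+ (t %% m) + f (t %/ m).

Let fH i : f i \in H.
Proof. by case: hf => _ _ _ ->; exists i. Qed.

Let m_odd : odd m.
Proof. by apply: dvdn_odd hodd; apply: mem_mulrn_dvd; rewrite mulr_card. Qed.

Lemma mod_inj_ext : mod_inj (m * N) g.
Proof.
case: hf => _ f_inj _ _ s t; rewrite eqn_mod_mul // -f_inj /g.
apply/eqP/andP => [e|[/eqP-> /eqP->] //].
have := coset_mod (fH _) (fH _) e; rewrite !modn_mod => e1.
by move: e; rewrite e1 => /addrI->.
Qed.

Lemma mod_inj_sum_ext : mod_inj (m * N) (fun t => g t + g t.+1).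
Proof.
case: hf => _ f_inj sum_inj _ s t; rewrite eqn_mod_mul //.
(* Going from [u] to [u.+1] carries into the quotient exactly when [u %% m] is [m.-1]; [c] is the
   multiple of [x] in the sum and [d] its part in [H]. *)
pose c r := (r + if r == m.-1 then 0 else r.+1)%N.
pose d q r := f q + (if r == m.-1 then f q.+1 else f q).
have gE u : g u + g u.+1 = x *+ c (u %% m)%N + d (u %/ m)%N (u %% m)%N.
  rewrite /g /c /d modnS divnS // addrACA -mulrnDr.
  have -> : (m %| u.+1)%N = (u %% m == m.-1)%N.
    have := eqn_modDr 1 u m.-1 m; rewrite !addn1 prednK // modnn.
    rewrite -/(dvdn _ _) => ->.
    by rewrite (@modn_small m.-1) ?prednK.
  by case: ifP => _; rewrite ?add1n ?add0n.
have dH q r : d q r \in H by rewrite /d; case: ifP => _; rewrite HD.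
rewrite !gE; apply/eqP/andP => [e|[/eqP-> eq_q]]; last first.
  congr (_ + _); rewrite /d; case: ifP => _; apply/eqP.
    by rewrite sum_inj.
  by move: eq_q; rewrite -f_inj => /eqP->.
have rs : s = t %[mod m].
  (* At a carry, [c] equals [m.-1], which is [2 * m.-1 + 1] minus [m]. *)
  have cE u : c (u %% m)%N = (2 * u).+1 %[mod m].
    rewrite -[in RHS]addn1 -[in RHS]modnDml -modnMmr modnDml /c.
    case: eqP => [->|_]; last by congr (_ %% m)%N; lia.
    rewrite addn0 -[in LHS]modnDr; congr (_ %% m)%N; lia.
  have := coset_mod (dH _ _) (dH _ _) e; rewrite !cE => /eqP.
  by rewrite -addn1 -[(2 * t).+1]addn1 eqn_modDr eqn_mod_double // => /eqP.
split; first exact/eqP.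
move: e; rewrite rs => /addrI; rewrite /d; case: ifP => _.
  by move/eqP; rewrite sum_inj.
by move/(double_inj hodd)/eqP; rewrite f_inj.
Qed.

Lemma harmonious_ext : exists2 K : {set A},
  harmonious K (m * N) g &
  [/\ x \in K, H \subset K & {in K &, forall a b, a - b \in K}].
Proof.
case: (hf) => N0 _ _ fE; pose K := [set g t | t : 'I_(m * N)].
have gK t : g t \in K.
  have mN : (t %% (m * N) < m * N)%N by rewrite ltn_mod muln_gt0 m_gt0.
  apply/imsetP; exists (Ordinal mN) => //=; apply/eqP.
  by rewrite mod_inj_ext modn_mod.
have xK k h : h \in H -> x *+ k + h \in K.
  move=> hH; have /fE[q qE] : x *+ (k %/ m * m) + h \in H by rewrite HD.
  (* The multiple [k %/ m * m] of [x] is absorbed into [H], where [f] reaches it at index [q]. *)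
  suff -> : x *+ k + h = g (q * m + k %% m)%N by [].
  rewrite /g modnMDl modn_mod divnMDl // (divn_small (ltn_pmod _ _)) // addn0.
  by rewrite qE addrA -mulrnDr addnC -divn_eq.
exists K; last split.
- split; [by rewrite muln_gt0 m_gt0|exact: mod_inj_ext|exact: mod_inj_sum_ext|].
  move=> a; split=> [/imsetP[t _ ->]|[t <-] //]; by exists t.
- by rewrite -[x]addr0 -{1}[x]mulr1n xK.
- by apply/subsetP=> h hH; rewrite -[h]add0r -(mulr0n x) xK.
- move=> _ _ /imsetP[s _ ->] /imsetP[t _ ->]; rewrite /g opprD addrACA.
  (* Multiplication by [#|A|.-1] acts as negation, which turns the difference into a natural
     multiple of [x], as [xK] requires. *)
  have -> : - (x *+ (t %% m)%N) = x *+ (t %% m * #|A|.-1).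
    apply/eqP; rewrite eq_sym -addr_eq0 -mulrnDr addnC -mulnS prednK.
      by rewrite mulnC mulrnA mulr_card mul0rn.
    exact: odd_gt0.
  by rewrite -mulrnDr xK // HB.
Qed.

End Extension.

Lemma harmonious_exists : odd #|A| -> exists f, harmonious [set: A] #|A| f.
Proof.
move=> hodd.
(* Induction over [enum A]: each stage gives a harmonious subgroup containing the elements met so
   far. At the end it is [A], which forces [N = #|A|]. *)
suff [H [HB [N [f hf]]]]: exists H : {set A}, {in H &, forall a b, a - b \in H}
    /\ exists N f, harmonious H N f /\ {subset enum A <= H}.
  case: hf => hf AH; have HT : H = setT.
    by apply/setP=> a; rewrite inE AH ?mem_enum.
  subst H; exists f; suff -> : #|A| = N by [].
  case: hf => N0 f_inj _ fT.
  rewrite -[RHS]card_ord -(card_codom (mod_inj_ord f_inj)); apply: eq_card => a.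
  have /fT[i <-] := in_setT a; apply/esym/codomP.
  exists (Ordinal (ltn_pmod i N0)).
  by apply/eqP; rewrite f_inj modn_mod.
elim: (enum A) => [|x s [H [HB [N [f [hf sH]]]]]].
  exists [set 0]; split=> [a b|].
    by rewrite !inE => /eqP-> /eqP->; rewrite subr0.
  exists 1%N, (fun=> 0); split=> //.
  split=> // [i j|i j|a]; rewrite ?modn1 ?eqxx //.
  by rewrite inE; split=> [/eqP->|[_ <-]] //; exists 0%N.
have H0 : 0 \in H.
  have f0 : f 0%N \in H by case: hf => _ _ _ ->; exists 0%N.
  by rewrite -(subrr (f 0%N)) HB.
have ex_m : exists k, (0 < k)%N && (x *+ k \in H).
  by exists #|A|; rewrite mulr_card H0 odd_gt0.
case: (ex_minnP ex_m) => m /andP[m_gt0 xm] m_min.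
have {}m_min k : (0 < k)%N -> x *+ k \in H -> (m <= k)%N.
  by move=> k_gt0 xk; apply: m_min; rewrite k_gt0.
have [K hK [xK HK KB]] := harmonious_ext H0 HB m_gt0 xm m_min hodd hf.
exists K; split=> //; do 2!eexists; split; first exact: hK.
by move=> a; rewrite inE => /predU1P[->//|/sH]; apply: (subsetP HK).
Qed.

(** By cardinality [f] reaches every [a] at some [r] in its first period, and the occurrences of [a]
    are the indices congruent to [r]. *)
Lemma mod_inj_count (f : nat -> A) (m : nat) (a : A) : mod_inj #|A| f ->
  (m %/ #|A| <= #|[set i : 'I_m | f i == a]| <= (m %/ #|A|).+1)%N.
Proof.
move=> f_inj.
have /codomP[r ->] : a \in codom (fun i : 'I_#|A| => f i).
  by apply: (inj_card_onto (mod_inj_ord f_inj)); rewrite card_ord.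
rewrite -sum1dep_card big_mkcond /=.
rewrite (eq_bigr (fun i : 'I_m => (i == r %[mod #|A|] : nat))).
  by apply: count_mod_bounds; apply/card_gt0P; exists 0.
by move=> i _; rewrite f_inj; case: eqP.
Qed.

End OddGroup.

(** * Labelling the paths *)

Theorem theorem1p6 (A : finZmodType) (hodd : odd #|A|) :
  class_cordial A is_path_graph.
Proof.
have [f [_ f_inj sum_inj _]] := harmonious_exists hodd.
move=> G [[//|m] _ [h [h' hK h'K] h_adj]].
have h_inj : injective h := can_inj hK.
pose l u := f (h' u); exists l; split.
  apply: (almost_rectangular_sort (k := (m.+1 %/ #|A|)%N)) => a.
  suff -> : #|[set u | l u == a]| = #|[set i : 'I_m.+1 | f i == a]|.
    exact: mod_inj_count.
  rewrite -(card_imset _ h_inj); apply: eq_card => u.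
  by rewrite -[u]h'K mem_imset // !inE /l hK.
(* The path has [m.+1] vertices, so its edges are indexed by ['I_m]. *)
pose e (i : 'I_m) : {set G} := [set h (inord i); h (inord i.+1)].
have inord0 (i : 'I_m) : (inord i : 'I_m.+1) = i :> nat.
  by rewrite inordK // leqW.
have inord1 (i : 'I_m) : (inord i.+1 : 'I_m.+1) = i.+1 :> nat.
  by rewrite inordK // ltnS.
have e_adj (i : 'I_m) : adj (h (inord i)) (h (inord i.+1)).
  by rewrite h_adj /= /path_adj inord0 inord1 eqxx.
have e_label i : edge_label l (e i) = f i + f i.+1.
  by rewrite edge_labelE // /l !hK; congr (f _ + f _).
have e_inj : injective e.
  move=> i j eij.
  have mem_e a : (h a \in e i) = (h a \in e j) by rewrite eij.
  (* The lower end of each edge lies on the other edge, so [i] is [j] or [j.+1] and [j] is [i] or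
     [i.+1]. *)
  have := mem_e (inord i); have := mem_e (inord j).
  rewrite !inE !(inj_eq h_inj) -!val_eqE /= !inord0 !inord1 => ei ej.
  by apply: val_inj => /=; lia.
have eE : edges G = [set e i | i : 'I_m].
  apply/setP=> E; apply/imset2P/imsetP => [[u v _ uv ->]|[i _ ->]]; last first.
    by exists (h (inord i)) (h (inord i.+1)) => //; apply: e_adj.
  have {uv} : adj u v := uv; rewrite -[u]h'K -[v]h'K h_adj /=.
  move: (h' u) (h' v) => {u v} a b; wlog ab : a b / a.+1 == b :> nat.
    move=> wl /orP[ab|ba]; first by apply: wl; rewrite // /path_adj ab.
    by rewrite setUC; apply: wl; rewrite // /path_adj ba.
  move=> _; have am : (a < m)%N by rewrite -ltnS (eqP ab).
  by exists (Ordinal am); rewrite // /e /= (eqP ab) !inord_val.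
apply: (almost_rectangular_sort (k := (m %/ #|A|)%N)) => a.
suff -> : #|[set E in edges G | edge_label l E == a]|
    = #|[set i : 'I_m | f i + f i.+1 == a]|.
  exact: (mod_inj_count _ _ sum_inj).
rewrite -(card_imset _ e_inj) eE; apply: eq_card => E; rewrite inE.
apply/andP/imsetP => [[/imsetP[i _ ->]] | [i ia ->]].
  by rewrite e_label => ia; exists i; rewrite ?inE.
by split; [apply: imset_f|move: ia; rewrite inE e_label].
Qed.
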